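(* Let $p$ be a prime with $p\equiv5\pmod 6$, and let $m\ge0$, $\alpha\ge0$, $n\ge0$ be integers. Then for every integer $i$ with $1\le i\le p-1$, $$\overline{S}_3^{\,4m+1}\big(6p^{2\alpha+2}n+(6i+p)p^{2\alpha+1}\big)\equiv0\pmod{8}.$$
   Context: For $|q|<1$ and a positive integer $k$, write $f_k=\prod_{j\ge1}(1-q^{kj})$. For a positive integer $r$, $\overline{S}_3^{\,r}(n)$ (number of $3$-Schur overpartitions of $n$ with $r$-tuples) is defined by $\sum_{n\ge0}\overline{S}_3^{\,r}(n)q^n=\prod_{n\ge1}\frac{(1+q^{2n-1})^r(1-q^{3(2n-1)})^r}{(1+q^{3(2n-1)})^r(1-q^{2n-1})^r}=\frac{f_2^{3r}f_3^{2r}f_{12}^r}{f_1^{2r}f_4^rf_6^{3r}}$. *)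

(* Defs.v *)
From HB Require Import structures.
From mathcomp Require Import all_boot all_order all_algebra.
From mathcomp Require Import boolp classical_sets.
From mathcomp Require Import ring.

Set Implicit Arguments.
Unset Strict Implicit.
Unset Printing Implicit Defensive.

Import GRing.Theory.
Local Open Scope ring_scope.

(* Generating functions are formal power series in q: the identities defining
   f_k and the overpartition numbers are identities of power series with
   integer coefficients, all of them convergent for |q| < 1. *)

Record fps (R : Type) := FPS { coefs : nat -> R }.

Notation "{ 'fps' R }" := (fps R) (format "{ 'fps'  R }") : type_scope.

HB.instance Definition _ (R : Type) := gen_eqMixin {fps R}.
HB.instance Definition _ (R : Type) := gen_choiceMixin {fps R}.

Lemma fpsP (R : Type) (a b : {fps R}) : coefs a =1 coefs b -> a = b.
Proof. by case: a b => [a] [b] /= /funext ->. Qed.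

Section Ring.
Variable R : comNzRingType.
Implicit Types a b c : {fps R}.

Definition fps0 : {fps R} := FPS (fun=> 0).
Definition fps1 : {fps R} := FPS (fun n => (n == 0%N)%:R).
Definition fps_opp a : {fps R} := FPS (fun n => - coefs a n).
Definition fps_add a b : {fps R} := FPS (fun n => coefs a n + coefs b n).
Definition fps_mul a b : {fps R} :=
  FPS (fun n => \sum_(i < n.+1) coefs a i * coefs b (n - i)).

Fact fps_addA : associative fps_add.
Proof. by move=> a b c; apply: fpsP => n; exact: addrA. Qed.
Fact fps_addC : commutative fps_add.
Proof. by move=> a b; apply: fpsP => n; exact: addrC. Qed.
Fact fps_add0 : left_id fps0 fps_add.
Proof. by move=> a; apply: fpsP => n; exact: add0r. Qed.
Fact fps_addN : left_inverse fps0 fps_opp fps_add.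
Proof. by move=> a; apply: fpsP => n; exact: addNr. Qed.

HB.instance Definition _ :=
  GRing.isZmodule.Build {fps R} fps_addA fps_addC fps_add0 fps_addN.

Definition fps_trunc (n : nat) a : {poly R} := \poly_(i < n.+1) coefs a i.

Lemma coef_fps_trunc n a i : (i <= n)%N -> (fps_trunc n a)`_i = coefs a i.
Proof. by move=> le_in; rewrite coef_poly ltnS le_in. Qed.

Lemma coef_fps_mul_trunc n a b i : (i <= n)%N ->
  coefs (fps_mul a b) i = (fps_trunc n a * fps_trunc n b)`_i.
Proof.
move=> le_in; rewrite coefM; apply: eq_bigr => j _.
rewrite !coef_fps_trunc //; first exact: leq_trans (leq_subr _ _) le_in.
exact: leq_trans (leq_ord j) le_in.
Qed.

Fact fps_mulA : associative fps_mul.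
Proof.
move=> a b c; apply: fpsP => n.
transitivity ((fps_trunc n a * (fps_trunc n b * fps_trunc n c))`_n).
  rewrite coefM; apply: eq_bigr => j _.
  rewrite coef_fps_trunc -1?ltnS // -coef_fps_mul_trunc //.
  exact: leq_subr.
rewrite mulrA coefM; apply: eq_bigr => j _.
rewrite -coef_fps_mul_trunc -1?ltnS // coef_fps_trunc //.
exact: leq_subr.
Qed.

Fact fps_mulC : commutative fps_mul.
Proof.
move=> a b; apply: fpsP => n.
by rewrite !(@coef_fps_mul_trunc n) // mulrC.
Qed.

Fact fps_mul1 : left_id fps1 fps_mul.
Proof.
move=> a; apply: fpsP => n; rewrite /= big_ord_recl /= mul1r subn0.
by rewrite big1 ?addr0 // => i _; rewrite mul0r.
Qed.

Fact fps_mulDl : left_distributive fps_mul fps_add.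
Proof.
move=> a b c; apply: fpsP => n; rewrite /= -big_split /=.
by apply: eq_bigr => i _; rewrite mulrDl.
Qed.

Fact fps_1_neq0 : fps1 != fps0.
Proof.
apply/eqP => /(congr1 (fun a => coefs a 0)) /= /eqP.
by rewrite oner_eq0.
Qed.

HB.instance Definition _ := GRing.Zmodule_isComNzRing.Build {fps R}
  fps_mulA fps_mulC fps_mul1 fps_mulDl fps_1_neq0.

Arguments fps1 : simpl never.
Arguments fps_opp : simpl never.
Arguments fps_add : simpl never.
Arguments fps_mul : simpl never.

Lemma coefs1 n : coefs (1 : {fps R}) n = (n == 0%N)%:R. Proof. by []. Qed.
Lemma coefs0 n : coefs (0 : {fps R}) n = 0. Proof. by []. Qed.
Lemma coefsD a b n : coefs (a + b) n = coefs a n + coefs b n.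
Proof. by []. Qed.
Lemma coefsN a n : coefs (- a) n = - coefs a n. Proof. by []. Qed.
Lemma coefsM a b n :
  coefs (a * b) n = \sum_(i < n.+1) coefs a i * coefs b (n - i).
Proof. by []. Qed.

End Ring.

Section Inverse.
Variable R : comUnitRingType.
Implicit Types a b : {fps R}.

(* [fps_inv_seq a n] lists the coefficients of degree n, ..., 0 of 1 / a,
   obtained from sum_(i <= n) a_i b_(n - i) = (n == 0). *)
Fixpoint fps_inv_seq a n : seq R :=
  if n is m.+1 then
    let s := fps_inv_seq a m in
    (- (coefs a 0)^-1 * \sum_(i < m.+1) coefs a i.+1 * s`_i) :: s
  else [:: (coefs a 0)^-1].

Definition fps_unit : pred {fps R} := fun a => coefs a 0 \is a GRing.unit.

Definition fps_inv a : {fps R} :=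
  if fps_unit a then FPS (fun n => (fps_inv_seq a n)`_0) else a.

Lemma nth_fps_inv_seq a n i : (i <= n)%N ->
  (fps_inv_seq a n)`_i = (fps_inv_seq a (n - i))`_0.
Proof.
elim: n i => [|n IHn] [|i] //=; rewrite ltnS => le_in.
by rewrite IHn // subSS.
Qed.

Fact fps_mulV : {in fps_unit, left_inverse 1 fps_inv *%R}.
Proof.
move=> a Ua; have a0U : coefs a 0 \is a GRing.unit by [].
rewrite /fps_inv [fps_unit a]Ua mulrC; apply: fpsP => n; rewrite coefsM coefs1 big_ord_recl /= subn0.
case: n => [|n]; first by rewrite big_ord0 addr0 divrr.
rewrite /= mulrA mulrN divrr // mulN1r.
apply/eqP; rewrite addrC subr_eq0; apply/eqP/eq_bigr => i _.
by rewrite [in RHS]nth_fps_inv_seq ?subSS // -ltnS.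
Qed.

Fact fps_unitPl a b : b * a = 1 -> fps_unit a.
Proof.
move/(congr1 (fun c => coefs c 0)); rewrite coefsM big_ord1 coefs1 => ba1.
by apply/unitrPr; exists (coefs b 0); rewrite mulrC.
Qed.

Fact fps_inv_out : {in [predC fps_unit], fps_inv =1 id}.
Proof. by move=> a aNU; rewrite /fps_inv ifN. Qed.

HB.instance Definition _ := GRing.ComNzRing_hasMulInverse.Build {fps R}
  fps_mulV fps_unitPl fps_inv_out.

Lemma fps_unitE a : (a \is a GRing.unit) = (coefs a 0 \is a GRing.unit).
Proof. by []. Qed.

End Inverse.

Section Limits.
Variable R : comNzRingType.
Implicit Types (a : {fps R}) (u F : nat -> {fps R}).

Definition fpsX : {fps R} := FPS (fun n => (n == 1%N)%:R).

Definition fps_cvg u a := forall n, exists N0, forall N,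
  (N0 <= N)%N -> coefs (u N) n = coefs a n.

Definition fps_lim u : {fps R} := xget 0 [set a | fps_cvg u a].

(* The product of the F k over k >= 1. *)
Definition infprod F : {fps R} := fps_lim (fun N => \prod_(1 <= k < N.+1) F k).

Lemma fps_cvg_unique u a b : fps_cvg u a -> fps_cvg u b -> a = b.
Proof.
move=> ua ub; apply: fpsP => n.
have [[N1 {}ua] [N2 {}ub]] := (ua n, ub n).
by rewrite -(ua (maxn N1 N2)) ?leq_maxl // ub // leq_maxr.
Qed.

Lemma fps_limE u a : fps_cvg u a -> fps_lim u = a.
Proof.
by move=> ua; apply: xget_unique => // b ub; apply: fps_cvg_unique ub ua.
Qed.

Definition fps_eqm (n : nat) a b := forall i, (i < n)%N -> coefs a i = coefs b i.

Lemma fps_eqmM n a b c d :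
  fps_eqm n a b -> fps_eqm n c d -> fps_eqm n (a * c) (b * d).
Proof.
move=> ab cd i lt_in; rewrite !coefsM; apply: eq_bigr => j _.
rewrite ab ?cd //; first exact: leq_ltn_trans (leq_subr _ _) lt_in.
exact: leq_ltn_trans (leq_ord j) lt_in.
Qed.

Lemma infprod_cvg F : (forall k, (0 < k)%N -> fps_eqm k (F k) 1) ->
  fps_cvg (fun N => \prod_(1 <= k < N.+1) F k) (infprod F).
Proof.
move=> F1; pose u N := \prod_(1 <= k < N.+1) F k.
suff ua : fps_cvg u (FPS (fun n => coefs (u n) n)).
  by rewrite /infprod (fps_limE ua).
move=> n; exists n => N; elim: N => [|N IHN]; first by case: n.
rewrite leq_eqVlt => /predU1P[<- //|lt_nN].
rewrite -[RHS]IHN // -[u N]mulr1 /u big_nat_recr //.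
by apply: (@fps_eqmM N.+1) => //; exact: F1.
Qed.

End Limits.

Notation "''q'" := (fpsX int) (at level 0) : ring_scope.

Definition schur_num (r n : nat) : {fps int} :=
  (1 + 'q ^+ (2 * n - 1)) ^+ r * (1 - 'q ^+ (3 * (2 * n - 1))) ^+ r.

Definition schur_den (r n : nat) : {fps int} :=
  (1 + 'q ^+ (3 * (2 * n - 1))) ^+ r * (1 - 'q ^+ (2 * n - 1)) ^+ r.

Definition schur_gf (r : nat) : {fps int} :=
  infprod (fun n => schur_num r n / schur_den r n).

Definition S3 (r n : nat) : int := coefs (schur_gf r) n.

Definition euler_f (k : nat) : {fps int} :=
  infprod (fun j => 1 - 'q ^+ (k * j)).

(* The limits above exist ([euler_f_cvg], [schur_gf_cvg]), and the generating
   function is the eta-quotient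
   f_2^(3r) f_3^(2r) f_12^r / (f_1^(2r) f_4^r f_6^(3r)) ([schur_gf_eta]). *)

Section EtaQuotient.
Implicit Types (a b : {fps int}) (u v : nat -> {fps int}).

Lemma fps_eqm1M n a b : fps_eqm n a 1 -> fps_eqm n b 1 -> fps_eqm n (a * b) 1.
Proof. by move=> a1 b1; rewrite -[1]mulr1; exact: fps_eqmM. Qed.

Lemma fps_eqm1X n r a : fps_eqm n a 1 -> fps_eqm n (a ^+ r) 1.
Proof.
by move=> a1; elim: r => [|r IHr]; rewrite ?expr0 // exprS; exact: fps_eqm1M.
Qed.

Lemma fps_eqm1V n a :
  a \is a GRing.unit -> fps_eqm n a 1 -> fps_eqm n a^-1 1.
Proof.
move=> aU a1 i lt_in; rewrite -[a^-1]mul1r -[in RHS](divrr aU).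
by apply: (@fps_eqmM _ n) => // j lt_jn; rewrite a1.
Qed.

Lemma coefs_fpsXn m i : coefs ('q ^+ m) i = (i == m)%:R.
Proof.
elim: m i => [|m IHm] i; first by rewrite expr0 coefs1.
rewrite exprS coefsM; case: i => [|i].
  by rewrite big_ord1 mul0r.
rewrite big_ord_recl big_ord_recl /= mul0r add0r mul1r IHm subSS subn0 eqSS.
by rewrite big1 ?addr0 // => j _; rewrite mul0r.
Qed.

Lemma fps_eqm1DXn n m : (n <= m)%N -> fps_eqm n (1 + 'q ^+ m) 1.
Proof.
move=> le_nm i lt_in; rewrite coefsD coefs_fpsXn.
by rewrite (ltn_eqF (leq_trans lt_in le_nm)) addr0.
Qed.

Lemma fps_eqm1BXn n m : (n <= m)%N -> fps_eqm n (1 - 'q ^+ m) 1.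
Proof.
move=> le_nm i lt_in; rewrite coefsD coefsN coefs_fpsXn.
by rewrite (ltn_eqF (leq_trans lt_in le_nm)) subr0.
Qed.

Lemma fps_eqm1_unit n a : (0 < n)%N -> fps_eqm n a 1 -> a \is a GRing.unit.
Proof. by move=> n_gt0 a1; rewrite fps_unitE a1. Qed.

Lemma fps_cvg_unit u a :
  (forall N, u N \is a GRing.unit) -> fps_cvg u a -> a \is a GRing.unit.
Proof.
by move=> uU /(_ 0%N)[N /(_ N (leqnn _)) aE]; rewrite fps_unitE -aE; exact: uU.
Qed.

Lemma fps_cvg_eqm u a n : fps_cvg u a ->
  exists N0, forall N, (N0 <= N)%N -> fps_eqm n (u N) a.
Proof.
move=> ua; elim: n => [|n [N1 IHn]]; first by exists 0%N => N _ [].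
have [N2 ua2] := ua n; exists (maxn N1 N2) => N; rewrite geq_max.
case/andP=> le1 le2 i; rewrite ltnS leq_eqVlt => /predU1P[-> |].
  exact: ua2.
exact: IHn.
Qed.

Lemma fps_cvgM u v a b :
  fps_cvg u a -> fps_cvg v b -> fps_cvg (fun N => u N * v N) (a * b).
Proof.
move=> /fps_cvg_eqm ua /fps_cvg_eqm vb n.
have [[N1 {}ua] [N2 {}vb]] := (ua n.+1, vb n.+1).
exists (maxn N1 N2) => N; rewrite geq_max => /andP[le1 le2].
by apply: (fps_eqmM (ua N le1) (vb N le2)).
Qed.

Lemma fps_cvgX u a r : fps_cvg u a -> fps_cvg (fun N => u N ^+ r) (a ^+ r).
Proof.
move=> ua; elim: r => [|r IHr].
  by move=> n; exists 0%N => N _; rewrite !expr0.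
rewrite exprS (_ : (fun N => _) = fun N => u N * u N ^+ r); last first.
  by apply/funext => N; rewrite exprS.
exact: fps_cvgM.
Qed.

Lemma fps_cvg_double u a : fps_cvg u a -> fps_cvg (fun N => u (2 * N)%N) a.
Proof.
move=> ua n; have [N0 {}ua] := ua n; exists N0 => N le_N.
by apply: ua; rewrite (leq_trans le_N) // leq_pmull.
Qed.

Let E k N : {fps int} := \prod_(1 <= j < N.+1) (1 - 'q ^+ (k * j)).
Let O k N : {fps int} := \prod_(1 <= j < N.+1) (1 - 'q ^+ (k * (2 * j - 1))).
Let P k N : {fps int} := \prod_(1 <= j < N.+1) (1 + 'q ^+ (k * (2 * j - 1))).
Let o k : {fps int} := infprod (fun j => 1 - 'q ^+ (k * (2 * j - 1))).
Let p k : {fps int} := infprod (fun j => 1 + 'q ^+ (k * (2 * j - 1))).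

Let odd_ge k j : (0 < k)%N -> (0 < j)%N -> (j <= k * (2 * j - 1))%N.
Proof.
move=> k0 j0; apply: (@leq_trans (2 * j - 1)%N); last exact: leq_pmull.
by rewrite mul2n -addnn -addnBA // leq_addr.
Qed.

Lemma euler_f_cvg k : (0 < k)%N -> fps_cvg (E k) (euler_f k).
Proof.
by move=> k0; apply: infprod_cvg => j j0; apply/fps_eqm1BXn/leq_pmull.
Qed.

Let O_cvg k : (0 < k)%N -> fps_cvg (O k) (o k).
Proof.
by move=> k0; apply: infprod_cvg => j j0; apply/fps_eqm1BXn/odd_ge.
Qed.

Let P_cvg k : (0 < k)%N -> fps_cvg (P k) (p k).
Proof.
by move=> k0; apply: infprod_cvg => j j0; apply/fps_eqm1DXn/odd_ge.
Qed.

Let OE k : (0 < k)%N -> euler_f k = o k * euler_f (2 * k).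
Proof.
move=> k0; apply: (fps_cvg_unique (fps_cvg_double (euler_f_cvg k0))).
rewrite (_ : (fun N => _) = fun N => O k N * E (2 * k) N); last first.
  apply/funext; rewrite /O /E; elim=> [|N IHN]; first by rewrite !big_geq ?mulr1.
  rewrite mulnS !addSn add0n 2?big_nat_recr //= IHN.
  rewrite [in RHS]big_nat_recr //= [X in _ = _ * X]big_nat_recr //=.
  rewrite (_ : 2 * N.+1 - 1 = (2 * N).+1)%N; last by rewrite mulnS addSn subn1.
  rewrite (_ : 2 * k * N.+1 = k * (2 * N).+2)%N; last first.
    by rewrite mulnAC [LHS]mulnC mulnS.
  by ring.
by apply: fps_cvgM; [exact: O_cvg | apply: euler_f_cvg; rewrite muln_gt0].
Qed.

Let PO k : (0 < k)%N -> o (2 * k) = p k * o k.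
Proof.
move=> k0; apply: (@fps_cvg_unique _ (O (2 * k))).
  by apply: O_cvg; rewrite muln_gt0.
rewrite (_ : O _ = fun N => P k N * O k N); last first.
  apply/funext => N; rewrite /O /P -big_split /=; apply: eq_bigr => j _.
  by rewrite -mulnA mulnC exprM; ring.
by apply: fps_cvgM; [exact: P_cvg | exact: O_cvg].
Qed.

Let num1 r n : (0 < n)%N -> fps_eqm n (schur_num r n) 1.
Proof.
move=> n0; apply: fps_eqm1M; apply: fps_eqm1X.
  by apply: fps_eqm1DXn; rewrite -[X in (_ <= X)%N]mul1n odd_ge.
by apply: fps_eqm1BXn; rewrite odd_ge.
Qed.

Let den1 r n : (0 < n)%N -> fps_eqm n (schur_den r n) 1.
Proof.
move=> n0; apply: fps_eqm1M; apply: fps_eqm1X.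
  by apply: fps_eqm1DXn; rewrite odd_ge.
by apply: fps_eqm1BXn; rewrite -[X in (_ <= X)%N]mul1n odd_ge.
Qed.

Let den_unit r n : (0 < n)%N -> schur_den r n \is a GRing.unit.
Proof. by move=> n0; apply: fps_eqm1_unit n0 (den1 _ n0). Qed.

Lemma schur_gf_cvg r :
  fps_cvg (fun N => \prod_(1 <= n < N.+1) (schur_num r n / schur_den r n))
          (schur_gf r).
Proof.
apply: infprod_cvg => n n0; apply: fps_eqm1M; first exact: num1.
by apply: fps_eqm1V; [exact: den_unit | exact: den1].
Qed.

Let unitE k : (0 < k)%N -> euler_f k \is a GRing.unit.
Proof.
move=> k0; apply: (fps_cvg_unit _ (euler_f_cvg k0)) => N.
rewrite /E big_nat; apply: rpred_prod => j /andP[j0 _].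
by apply: fps_eqm1_unit j0 _; apply/fps_eqm1BXn/leq_pmull.
Qed.

Let unitO k : (0 < k)%N -> o k \is a GRing.unit.
Proof. by move=> k0; move: (unitE k0); rewrite OE // unitrM => /andP[]. Qed.

Let unitP k : (0 < k)%N -> p k \is a GRing.unit.
Proof.
move=> k0; have: o (2 * k) \is a GRing.unit by rewrite unitO ?muln_gt0.
by rewrite PO // unitrM => /andP[].
Qed.

Lemma schur_gf_eta r : schur_gf r =
  (euler_f 2 ^+ (3 * r) * euler_f 3 ^+ (2 * r) * euler_f 12 ^+ r)
  / (euler_f 1 ^+ (2 * r) * euler_f 4 ^+ r * euler_f 6 ^+ (3 * r)).
Proof.
have S_eq : schur_gf r * (p 3 * o 1) ^+ r = (p 1 * o 3) ^+ r.
  apply: (@fps_cvg_unique _ (fun N => (P 1 N * O 3 N) ^+ r)); last first.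
    by apply: fps_cvgX; apply: fps_cvgM; [exact: P_cvg | exact: O_cvg].
  rewrite (_ : (fun N => _) = fun N =>
      (\prod_(1 <= n < N.+1) (schur_num r n / schur_den r n))
      * (P 3 N * O 1 N) ^+ r).
    apply: fps_cvgM; first exact: schur_gf_cvg.
    by apply: fps_cvgX; apply: fps_cvgM; [exact: P_cvg | exact: O_cvg].
  apply/funext => N; rewrite /P /O -!big_split -!prodrXl -big_split /=.
  rewrite !big_nat; apply: eq_bigr => n /andP[n0 _].
  rewrite [X in _ / _ * X](_ : _ = schur_den r n); last first.
    by rewrite /schur_den mul1n exprMn.
  by rewrite divrK ?den_unit // /schur_num mul1n exprMn.
have X_unit : (p 3 * o 1) ^+ r \is a GRing.unit.
  by rewrite unitrX // unitrM unitP ?unitO.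
have D_unit : euler_f 1 ^+ (2 * r) * euler_f 4 ^+ r * euler_f 6 ^+ (3 * r)
    \is a GRing.unit by rewrite !unitrM !unitrX ?unitE.
apply: (mulIr D_unit); rewrite divrK //; apply: (mulIr X_unit).
rewrite mulrAC S_eq !exprM -!exprMn; congr (_ ^+ r).
have e6 : euler_f 6 = p 3 * o 3 * euler_f 12 by rewrite -PO // -OE.
have e3 : euler_f 3 = o 3 * euler_f 6 by rewrite -OE.
have e2 : euler_f 2 = p 1 * o 1 * euler_f 4 by rewrite -PO // -OE.
have e1 : euler_f 1 = o 1 * euler_f 2 by rewrite -OE.
by rewrite e1 e3 e2 e6; ring.
Qed.

End EtaQuotient.

(* Main.v *)
Require Import Defs.
From mathcomp Require Import all_boot all_order all_algebra.
From mathcomp Require Import boolp ring zify.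

Set Implicit Arguments.
Unset Strict Implicit.
Unset Printing Implicit Defensive.

Import Order.TTheory GRing.Theory Num.Theory.

(** By Gauss, f_k^2 / f_(2k) = 1 + 2 t_k with t_k = sum_(x >= 1) (-1)^x q^(k x^2),
    so the generating function for r = 1 is
    (1 + 2 t_2)(1 + 2 t_3) / ((1 + 2 t_1)(1 + 2 t_6)). It is 1 modulo 2, hence its
    fourth power is 1 modulo 8 and r = 4m + 1 reduces to r = 1. The index is
    N = p^(2 alpha + 1) M with M = 5 mod 6 prime to p, so N = 1 mod 6. Expanding
    modulo 8, congruences and the odd p-adic valuation of N kill everything at N
    except 4 t_1 t_k for k = 2, 3, 6, and one has to see that
    x^2 + k y^2 = N has an even number of positive solutions. If -k is not a square
    modulo p (always so for k = 3), descent leaves none. Otherwise Thue's lemma gives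
    p = a u^2 + b w^2 with (a, b) = (1, 2) or (2, 3), ab = k, and the Hecke relations
    between x^2 + ab y^2 and a x^2 + b y^2 propagate the divisibility by 4 of the
    number of integer representations of M by a x^2 + b y^2 to divisibility by 8 of
    that of N by x^2 + k y^2, which is four times the number of positive ones. *)

(** * Integer solutions of a x^2 + b y^2 = N, and the Hecke relation between two such forms *)

Section Representations.
Local Open Scope ring_scope.

Definition box (N : nat) : seq int :=
  0 :: [seq n%:Z | n <- iota 1 N] ++ [seq - n%:Z | n <- iota 1 N].

Lemma mem_box N x : (x \in box N) = (`|x| <= N)%N.
Proof.
rewrite inE mem_cat; apply/idP/idP.
  case/or3P => [/eqP->//|/mapP[n]|/mapP[n]]; rewrite mem_iota => + ->; lia.
move=> xN; case: (ltgtP x 0) => //= x0; apply/orP; [right|left];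
  apply/mapP; exists `|x|%N; rewrite ?mem_iota; lia.
Qed.

Lemma box_uniq N : uniq (box N).
Proof.
rewrite /= mem_cat cat_uniq !map_inj_uniq ?iota_uniq; try by move=> x y; lia.
rewrite /= andbT; apply/andP; split.
  by apply/norP; split; apply/negP => /mapP[n]; rewrite mem_iota; lia.
apply/hasPn => _ /mapP[n + ->]; rewrite mem_iota => n1.
by apply/negP => /mapP[m]; rewrite mem_iota; lia.
Qed.

(** For positive [a] and [b] the box contains every integer solution; the list has no repetitions,
    so its size is the full representation number. *)
Definition reps (a b N : nat) : seq (int * int) :=
  [seq z <- [seq (x, y) | x <- box N, y <- box N]
     | a%:Z * z.1 ^+ 2 + b%:Z * z.2 ^+ 2 == N%:Z].

Lemma reps_uniq a b N : uniq (reps a b N).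
Proof. by rewrite filter_uniq // allpairs_uniq ?box_uniq // => -[? ?] []. Qed.

Lemma sqr_absz (x : int) : x ^+ 2 = (`|x| ^ 2)%N%:Z.
Proof. by rewrite -abszX; lia. Qed.

Lemma mem_reps a b N z : (0 < a)%N -> (0 < b)%N ->
  (z \in reps a b N) = (a%:Z * z.1 ^+ 2 + b%:Z * z.2 ^+ 2 == N%:Z).
Proof.
move=> a0 b0; rewrite mem_filter andb_idr // => /eqP.
case: z => x y; rewrite [(x,y).1]/= [(x,y).2]/= !sqr_absz -!PoszM -PoszD => -[e].
by apply: (allpairs_f (@pair int int)); rewrite mem_box; nia.
Qed.

Lemma dvdz_prime_mul (p : nat) x y :
  prime p -> (p %| x * y)%Z = (p %| x)%Z || (p %| y)%Z.
Proof. by move=> pp; rewrite !dvdzE abszM Euclid_dvdM. Qed.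

(* A solution (x, y) of F(x, y) = p N lifts through (X, Y) |-> (alpha X + beta Y, gamma Y - delta X)
   or through its twin with beta, delta negated, and through both iff p divides x and y;
   inclusion-exclusion on the two images gives the identity. *)
Lemma hecke_relation (p c d c' d' N : nat) (alpha beta gamma delta : int) :
  prime p -> odd p -> (0 < c)%N -> (0 < d)%N -> (0 < c')%N -> (0 < d')%N ->
  alpha * gamma + beta * delta = p%:Z ->
  c%:Z * alpha ^+ 2 + d%:Z * delta ^+ 2 = p%:Z * c'%:Z ->
  c%:Z * beta ^+ 2 + d%:Z * gamma ^+ 2 = p%:Z * d'%:Z ->
  c%:Z * alpha * beta = d%:Z * gamma * delta ->
  ~~ (p %| d)%N -> ~~ (p %| alpha)%Z -> ~~ (p %| delta)%Z ->
  (size (reps c d (p * N)) + size (reps (p * c) (p * d) N) =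
     2 * size (reps c' d' N))%N.
Proof.
move=> pp podd c0 d0 c0' d0' e1 e2 e3 e4 pd pal pde.
have p0 := prime_gt0 pp.
have pz : p%:Z != 0 by rewrite eqz_nat -lt0n.
have pdz : (p %| d%:Z)%Z = false by rewrite dvdzE; exact: negbTE pd.
pose A (z : int * int) := (alpha * z.1 + beta * z.2, gamma * z.2 - delta * z.1).
pose B (z : int * int) := (alpha * z.1 - beta * z.2, gamma * z.2 + delta * z.1).
have Ainj : injective A.
  move=> [x y] [x' y'] [] h1 h2; apply/eqP; rewrite xpair_eqE.
  by apply/andP; split; apply/eqP; apply: (mulfI pz); rewrite -e1;
    [have := congr2 (fun u v => gamma * u - beta * v) h1 h2
    |have := congr2 (fun u v => delta * u + alpha * v) h1 h2] => /= h;
    apply: (etrans _ (etrans h _)); ring.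
have Binj : injective B.
  move=> [x y] [x' y'] [] h1 h2; apply/eqP; rewrite xpair_eqE.
  by apply/andP; split; apply/eqP; apply: (mulfI pz); rewrite -e1;
    [have := congr2 (fun u v => gamma * u + beta * v) h1 h2
    |have := congr2 (fun u v => alpha * v - delta * u) h1 h2] => /= h;
    apply: (etrans _ (etrans h _)); ring.
pose LA := [seq A z | z <- reps c' d' N].
pose LB := [seq B z | z <- reps c' d' N].
pose F x y : int := c%:Z * x ^+ 2 + d%:Z * y ^+ 2.
have FA z : F (A z).1 (A z).2 = p%:Z * (c'%:Z * z.1 ^+ 2 + d'%:Z * z.2 ^+ 2).
  rewrite /F /= mulrDr !mulrA -e2 -e3.
  apply/eqP; rewrite -subr_eq0; apply/eqP.
  apply: (etrans (y := 2 * z.1 * z.2 * (c%:Z * alpha * beta - d%:Z * gamma * delta))); first by ring.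
  by rewrite e4; ring.
have FB z : F (B z).1 (B z).2 = p%:Z * (c'%:Z * z.1 ^+ 2 + d'%:Z * z.2 ^+ 2).
  rewrite /F /= mulrDr !mulrA -e2 -e3.
  apply/eqP; rewrite -subr_eq0; apply/eqP.
  apply: (etrans (y := -2 * z.1 * z.2 * (c%:Z * alpha * beta - d%:Z * gamma * delta))); first by ring.
  by rewrite e4; ring.
have memA w : (w \in LA) =
    (F w.1 w.2 == (p * N)%N%:Z) && (p %| delta * w.1 + alpha * w.2)%Z.
  apply/mapP/andP.
    case=> z; rewrite mem_reps // => /eqP ez ->; rewrite FA ez PoszM; split=> //.
    apply/dvdzP; exists z.2; rewrite -e1 /=; ring.
  (* By [e1] the matrix of [A] has determinant p, so its inverse sends (x, y) to (gamma x - beta y,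
     delta x + alpha y) / p. The second quotient is given; the first is integral because delta
     (gamma x - beta y) = gamma (delta x + alpha y) - p y and p does not divide delta. *)
  case: w => x y /= [/eqP ef /dvdzP[Y eY]].
  have : (p %| delta * (gamma * x - beta * y))%Z.
    apply/dvdzP; exists (gamma * Y - y); rewrite mulrBl -mulrA -eY -e1; ring.
  rewrite dvdz_prime_mul // (negPf pde) /= => /dvdzP[X eX].
  have exy : (x, y) = A (X, Y).
    apply/eqP; rewrite xpair_eqE /=; apply/andP; split; apply/eqP;
      apply: (mulIf pz); rewrite mulrDl ?mulNr -!mulrA -eX -eY -e1; ring.
  exists (X, Y) => //; rewrite mem_reps //; apply/eqP/(mulfI pz).
  by rewrite -FA -exy ef PoszM.
have memB w : (w \in LB) =
    (F w.1 w.2 == (p * N)%N%:Z) && (p %| delta * w.1 - alpha * w.2)%Z.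
  apply/mapP/andP.
    case=> z; rewrite mem_reps // => /eqP ez ->; rewrite FB ez PoszM; split=> //.
    apply/dvdzP; exists (- z.2); rewrite mulNr -mulrN -e1 /=; ring.
  case: w => x y /= [/eqP ef /dvdzP[Y eY]].
  have : (p %| delta * (gamma * x + beta * y))%Z.
    apply/dvdzP; exists (gamma * Y + y); rewrite mulrDl -mulrA -eY -e1; ring.
  rewrite dvdz_prime_mul // (negPf pde) /= => /dvdzP[X eX].
  have exy : (x, y) = B (X, - Y).
    apply/eqP; rewrite xpair_eqE /=; apply/andP; split; apply/eqP;
      apply: (mulIf pz).
      transitivity (alpha * (X * p%:Z) + beta * (Y * p%:Z)); last by ring.
      by rewrite -eX -eY -e1; ring.
    transitivity (delta * (X * p%:Z) - gamma * (Y * p%:Z)); last by ring.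
    by rewrite -eX -eY -e1; ring.
  exists (X, - Y) => //; rewrite mem_reps //; apply/eqP/(mulfI pz).
  by rewrite -FB -exy ef PoszM.
have U : perm_eq (undup (LA ++ LB)) (reps c d (p * N)).
  apply: uniq_perm; rewrite ?undup_uniq ?reps_uniq // => -[x y].
  rewrite mem_undup mem_cat memA memB mem_reps // -andb_orr /= andb_idr // => /eqP ef.
  (* By [e2] this product is p c' x^2 - alpha^2 [F x y], where [F x y] is p N. Hence every solution
     lies in one of the two images. *)
  have : (p %| d%:Z * ((delta * x + alpha * y) * (delta * x - alpha * y)))%Z.
    apply/dvdzP; exists (c'%:Z * x ^+ 2 - alpha ^+ 2 * N%:Z).
    have -> : (c'%:Z * x ^+ 2 - alpha ^+ 2 * N%:Z) * p%:Z =
      (p%:Z * c'%:Z) * x ^+ 2 - alpha ^+ 2 * (p * N)%N%:Z by rewrite PoszM; ring.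
    by rewrite -ef -e2 /F; ring.
  by rewrite !dvdz_prime_mul // pdz.
have I : perm_eq [seq w <- LA | w \in LB]
    [seq (p%:Z * z.1, p%:Z * z.2) | z <- reps (p * c) (p * d) N].
  apply: uniq_perm.
  - by rewrite filter_uniq // map_inj_uniq ?reps_uniq.
  - rewrite map_inj_uniq ?reps_uniq // => -[x y] [x' y'] [].
    by move=> /(mulfI pz) -> /(mulfI pz) ->.
  move=> [x y]; rewrite mem_filter memA memB /=; apply/idP/mapP.
    case/andP => /andP[/eqP ef d1] /andP[_ d2].
    have : (p %| delta * x)%Z.
      have : (p %| 2%:Z * (delta * x))%Z.
        by rewrite (_ : _ * _ = delta * x + alpha * y + (delta * x - alpha * y));
          [exact: rpredD | ring].
      rewrite dvdz_prime_mul // dvdzE /=.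
      by rewrite dvdn_prime2 // => /orP[/eqP e|//]; move: podd; rewrite e.
    rewrite dvdz_prime_mul // (negPf pde) /= => /dvdzP[X eX].
    have : (p %| alpha * y)%Z.
      rewrite (_ : alpha * y = (delta * x + alpha * y) - delta * x); last by ring.
      by rewrite rpredB // eX mulrA dvdz_mull.
    rewrite dvdz_prime_mul // (negPf pal) /= => /dvdzP[Y eY].
    exists (X, Y); last by rewrite /= eX eY ![p%:Z * _]mulrC.
    rewrite mem_reps ?muln_gt0 ?p0 //=; apply/eqP/(mulfI pz).
    by rewrite -PoszM -ef /F eX eY !PoszM; ring.
  case=> -[X Y]; rewrite mem_reps ?muln_gt0 ?p0 //= => /eqP ef [-> ->].
  have -> : F (p%:Z * X) (p%:Z * Y) == (p * N)%N%:Z.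
    by rewrite PoszM -ef /F !PoszM; apply/eqP; ring.
  rewrite /= !(mulrCA _ p%:Z) -mulrDr -mulrBr !dvdz_mulr //.
rewrite -(perm_size U).
rewrite -[size (reps (p * c) _ _)](size_map (fun z => (p%:Z * z.1, p%:Z * z.2))).
rewrite -(perm_size I).
have uA : uniq LA by rewrite map_inj_uniq ?reps_uniq.
have uB : uniq LB by rewrite map_inj_uniq ?reps_uniq.
rewrite undup_cat (undup_id uA) (undup_id uB) size_cat !size_filter addnAC.
have h : (count (fun w => w \notin LB) LA + count (fun w => w \in LB) LA = size LA)%N.
  by rewrite addnC; exact: count_predC (mem LB) LA.
transitivity (size LA + size LB)%N; first by congr (_ + _)%N; exact: h.
by rewrite !size_map !size_filter mul2n addnn.
Qed.

End Representations.

(** * Diagonal forms that represent the prime p *)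

Section PrimeForm.
Local Open Scope ring_scope.
Variables (p a b : nat) (u w : int).
Hypotheses (p_prime : prime p) (p_odd : odd p) (pNa : ~~ (p %| a)%N) (pNb : ~~ (p %| b)%N).
Hypothesis p_form : p%:Z = a%:Z * u ^+ 2 + b%:Z * w ^+ 2.

Let a_gt0 : (0 < a)%N. Proof. by case: a pNa => //; rewrite dvdn0. Qed.
Let b_gt0 : (0 < b)%N. Proof. by case: b pNb => //; rewrite dvdn0. Qed.
Let ab_gt0 : (0 < a * b)%N. Proof. by rewrite muln_gt0 a_gt0. Qed.
Let p_gt0 : (0 < p)%N. Proof. exact: prime_gt0. Qed.
Let pNaz : (p %| a%:Z)%Z = false. Proof. by rewrite dvdzE; exact: negbTE pNa. Qed.
Let pNbz : (p %| b%:Z)%Z = false. Proof. by rewrite dvdzE; exact: negbTE pNb. Qed.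

(** Otherwise p^2 would divide p. *)
Let not_both (x y : int) : (p %| x)%Z -> (p %| y)%Z ->
  p%:Z = a%:Z * x ^+ 2 + b%:Z * y ^+ 2 -> False.
Proof.
case/dvdzP=> s -> /dvdzP[t ->] e.
have : p%:Z * 1 = p%:Z * (p%:Z * (a%:Z * s ^+ 2 + b%:Z * t ^+ 2)).
  by rewrite mulr1 {1}e; ring.
have pz : p%:Z != 0 by rewrite eqz_nat -lt0n.
move/(mulfI pz) => h.
have : (p %| 1)%Z.
  by apply/dvdzP; exists (a%:Z * s ^+ 2 + b%:Z * t ^+ 2); rewrite mulrC -h.
by rewrite dvdzE /= dvdn1 => /eqP p1; move: p_prime; rewrite p1.
Qed.

Let pNu : (p %| u)%Z = false.
Proof.
apply/negP => pu; apply: (not_both pu _ p_form).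
have : (p %| b%:Z * (w * w))%Z.
  rewrite (_ : _ * _ = p%:Z - a%:Z * u * u); last by rewrite p_form; ring.
  by rewrite rpredB // dvdz_mull.
by rewrite !dvdz_prime_mul // pNbz orbb.
Qed.

Let pNw : (p %| w)%Z = false.
Proof.
apply/negP => pw; apply: (not_both _ pw p_form).
have : (p %| a%:Z * (u * u))%Z.
  rewrite (_ : _ * _ = p%:Z - b%:Z * w * w); last by rewrite p_form; ring.
  by rewrite rpredB // dvdz_mull.
by rewrite !dvdz_prime_mul // pNaz orbb.
Qed.

(** Comes from the composition (a u X + b w Y)^2 + a b (u Y - w X)^2 = p (a X^2 + b Y^2). *)
Lemma hecke_principal N :
  (size (reps 1 (a * b) (p * N)) + size (reps (p * 1) (p * (a * b)) N) =
     2 * size (reps a b N))%N.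
Proof.
apply: (@hecke_relation p 1 (a * b) a b N (a%:Z * u) (b%:Z * w) u w) => //.
- by rewrite p_form; ring.
- by rewrite PoszM p_form; ring.
- by rewrite PoszM p_form; ring.
- by rewrite PoszM; ring.
- by rewrite Euclid_dvdM // negb_or pNa.
- by rewrite dvdz_prime_mul // pNaz pNu.
- by rewrite pNw.
Qed.

(** Comes from the reverse composition a (u X - b w Y)^2 + b (a u Y + w X)^2 = p (X^2 + a b Y^2). *)
Lemma hecke_twisted N :
  (size (reps a b (p * N)) + size (reps (p * a) (p * b) N) =
     2 * size (reps 1 (a * b) N))%N.
Proof.
apply: (@hecke_relation p a b 1 (a * b) N u (- (b%:Z * w)) (a%:Z * u) (- w)) => //.
- by rewrite p_form; ring.
- by rewrite p_form; ring.
- by rewrite PoszM p_form; ring.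
- by ring.
- by rewrite pNu.
- by rewrite rpredN pNw.
Qed.

Lemma size_reps_scale c d N : (0 < c)%N -> (0 < d)%N ->
  size (reps (p * c) (p * d) (p * N)) = size (reps c d N).
Proof.
move=> c0 d0; apply/perm_size/uniq_perm; rewrite ?reps_uniq // => z.
rewrite !mem_reps ?muln_gt0 ?p_gt0 // !PoszM -!mulrA -mulrDr.
by rewrite (inj_eq (mulfI _)) // eqz_nat -lt0n.
Qed.

Lemma size_reps_ndvd c d N : (0 < c)%N -> (0 < d)%N -> ~~ (p %| N)%N ->
  size (reps (p * c) (p * d) N) = 0%N.
Proof.
move=> c0 d0 pN; apply/eqP; rewrite size_eq0; apply/negPn/negP => /eqP.
case E: (reps _ _ _) => [//|z s] _.
have : z \in reps (p * c) (p * d) N by rewrite E mem_head.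
rewrite mem_reps ?muln_gt0 ?p_gt0 // => /eqP e; move/negP: pN; apply.
have : (p %| N%:Z)%Z by rewrite -e !PoszM -!mulrA -mulrDr dvdz_mulr.
by rewrite dvdzE.
Qed.

(** Let g_j and f_j count the representations of p^j M by a x^2 + b y^2 and x^2 + a b y^2. The Hecke
    relations read g_(2k+2) + g_(2k) = 2 f_(2k+1) and f_(2k+3) + f_(2k+1) = 2 g_(2k+2), with f_1 = 2
    g_0 because p does not divide M. So 4 | g and 8 | f climb together. *)
Lemma reps_odd_power_mod8 M k : ~~ (p %| M)%N -> (4 %| size (reps a b M))%N ->
  (4 %| size (reps a b (p ^ (2 * k) * M)))%N /\
  (8 %| size (reps 1 (a * b) (p ^ (2 * k + 1) * M)))%N.
Proof.
move=> pM M4; elim: k => [|k [IHg IHf]].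
  split; first by rewrite mul1n.
  have := hecke_principal M; rewrite size_reps_ndvd // addn0 expn1 => ->.
  by rewrite (@dvdn_mul 2 4).
have e1 : (p ^ (2 * k.+1) * M = p * (p ^ (2 * k + 1) * M))%N.
  by rewrite mulnA -expnS; congr (_ ^ _ * _)%N; lia.
have e2 : (p ^ (2 * k + 1) * M = p * (p ^ (2 * k) * M))%N.
  by rewrite mulnA -expnS addn1.
have e3 : (p ^ (2 * k.+1 + 1) * M = p * (p ^ (2 * k.+1) * M))%N.
  by rewrite mulnA -expnS addn1.
have g4 : (4 %| size (reps a b (p ^ (2 * k.+1) * M)))%N.
  have := hecke_twisted (p ^ (2 * k + 1) * M)%N.
  rewrite -e1 [in reps (p * a) _ _]e2 size_reps_scale // => e.
  by rewrite -(dvdn_addl _ IHg) e dvdn_mull // (dvdn_trans _ IHf).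
split=> //; have := hecke_principal (p ^ (2 * k.+1) * M)%N.
rewrite -e3 [in reps (p * 1) _ _]e1 size_reps_scale // => e.
by rewrite -(dvdn_addl _ IHf) e (@dvdn_mul 2 4).
Qed.

End PrimeForm.

(** * Thue's lemma and primes represented by small forms *)

Section Thue.
Local Open Scope ring_scope.

(** Pigeonhole: take e^2 < p < (e + 1)^2, strict since a prime is no square. Then (i, j) |-> Y i - X
    j mod p on [0, e]^2 repeats a value, and u, w are the coordinate differences, at most e in
    absolute value. *)
Lemma thue (p : nat) (X Y : int) : prime p ->
  exists u w : int, [/\ (u != 0) || (w != 0), (`|u| ^ 2 < p)%N,
    (`|w| ^ 2 < p)%N & (p %| Y * u - X * w)%Z].
Proof.
move=> pp; have p1 := prime_gt1 pp; have p0 := prime_gt0 pp.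
have exn : exists n, (p <= n ^ 2)%N by exists p; nia.
case: (ex_minnP exn) => -[|e] pe emin; first by lia.
have ep : (e ^ 2 < p)%N by rewrite ltnNge; apply/negP => /emin; lia.
have pe' : (p < e.+1 ^ 2)%N.
  rewrite ltn_neqAle pe andbT; apply/eqP => ep2.
  case/primeP: pp => _ /(_ e.+1); rewrite ep2 -mulnn dvdn_mulr // => /(_ isT).
  by clear -ep2 p1; nia.
pose f (z : 'I_e.+1 * 'I_e.+1) : 'I_p :=
  Ordinal (ltn_pmod `|((Y * z.1%:Z - X * z.2%:Z) %% p)%Z|%N p0).
have : ~~ injectiveb f.
  apply/negP => /injectiveP /leq_card; rewrite card_prod !card_ord; lia.
case/injectivePn => -[i j] [[i' j']] ne /(congr1 val) /=.
rewrite !modn_small; try by rewrite -ltz_nat gez0_abs ?modz_ge0 ?ltz_pmod; lia.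
move=> /(congr1 Posz); rewrite !gez0_abs ?modz_ge0; try by lia.
move/eqP; rewrite eqz_mod_dvd => pd.
exists (i%:Z - i'%:Z), (j%:Z - j'%:Z); split.
- by move: ne; rewrite xpair_eqE negb_and -!val_eqE /=; lia.
- by move: (ltn_ord i) (ltn_ord i') => ? ?; nia.
- by move: (ltn_ord j) (ltn_ord j') => ? ?; nia.
- rewrite (_ : _ - _ = Y * i%:Z - X * j%:Z - (Y * i'%:Z - X * j'%:Z)) //; ring.
Qed.

(** Thue's lemma for X and a Y: modulo p, a Y^2 (a u^2 + b w^2) equals (a Y u)^2 - (X w)^2 = 0, and
    the bounds on u, w keep the multiple below (a + b) p. *)
Lemma thue_form (p a b : nat) (X Y : int) : prime p -> (0 < a)%N -> (0 < b)%N ->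
  ~~ (p %| a)%N -> ~~ (p %| Y)%Z -> (p %| X ^+ 2 + (a * b)%N%:Z * Y ^+ 2)%Z ->
  exists u w : int, exists2 j : nat, (0 < j < a + b)%N &
    a%:Z * u ^+ 2 + b%:Z * w ^+ 2 = j%:Z * p%:Z.
Proof.
move=> pp a0 b0 pa pY pXY.
have [u [w [uw0 up wp pd]]] := thue X (a%:Z * Y) pp; exists u, w.
have : (p %| a%:Z * (Y * (Y * (a%:Z * u ^+ 2 + b%:Z * w ^+ 2))))%Z.
  rewrite (_ : _ * _ = (a%:Z * Y * u - X * w) * (a%:Z * Y * u + X * w) +
     w ^+ 2 * (X ^+ 2 + (a * b)%N%:Z * Y ^+ 2)); last by rewrite PoszM; ring.
  by rewrite rpredD ?(dvdz_mulr _ pd) ?dvdz_mull.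
rewrite !dvdz_prime_mul // (negPf pY) dvdzE /= (negPf pa) /= => /dvdzP[j ej].
clear pd pXY X; have p0 := prime_gt0 pp.
move: ej; rewrite !sqr_absz; move: uw0; rewrite -!absz_gt0.
move: up wp; move: `|u|%N `|w|%N => {pY} U W Up Wp UW ej.
have j0 : 0 < j by nia.
exists `|j|%N; last by rewrite ej; lia.
case: j j0 ej => // j j0 ej; rewrite absz_nat.
have {}ej : (a * U ^ 2 + b * W ^ 2 = j * p)%N by lia.
have : (j * p < (a + b) * p)%N by nia.
by rewrite ltn_pmul2r //; lia.
Qed.

Lemma dvdz2_sqr (x : int) : (2 %| x ^+ 2)%Z -> exists y, x = 2 * y.
Proof. by rewrite expr2 (@dvdz_prime_mul 2) // orbb => /dvdzP[y ->]; exists y; ring. Qed.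

(** The multiplier is 1 or 2; if it is 2, then u is even and halving gives p = w^2 + 2 (u/2)^2. *)
Lemma prime_form_1_2 (p : nat) (X Y : int) : prime p -> odd p -> ~~ (p %| Y)%Z ->
  (p %| X ^+ 2 + 2 * Y ^+ 2)%Z -> exists u w : int, p%:Z = 1%N%:Z * u ^+ 2 + 2%N%:Z * w ^+ 2.
Proof.
move=> pp podd pY pXY.
have [|u [w [[|[|[|j]]] // _ e]]] := @thue_form p 1 2 X Y pp isT isT _ pY pXY.
- by rewrite dvdn1; apply/eqP => p1; rewrite p1 in pp.
- by exists u, w; rewrite e mul1r.
have [|u' eu] := @dvdz2_sqr u.
  apply/dvdzP; exists (p%:Z - w ^+ 2); apply: (etrans (y := (2%:Z * p%:Z) - 2%:Z * w ^+ 2)); last by ring.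
  by rewrite -e; ring.
exists w, u'; apply: (@mulfI _ 2%:Z) => //; rewrite -e eu; ring.
Qed.

Lemma sqr_mod3 (x : int) : exists t : int, x ^+ 2 = 3 * t \/ x ^+ 2 = 3 * t + 1.
Proof.
have : exists t : int, [\/ x = 3 * t, x = 3 * t + 1 | x = 3 * t + 2].
  have := divz_eq x 3; have : 0 <= (x %% 3)%Z < 3 by rewrite modz_ge0 // ltz_pmod.
  move: (x %/ 3)%Z => q; case: (x %% 3)%Z => [[|[|[|?]]]|] // _ ->; exists q;
    [constructor 1|constructor 2|constructor 3]; rewrite ?addr0 mulrC //.
case=> t [] ->; [exists (3 * t ^+ 2); left|exists (3 * t ^+ 2 + 2 * t); right
  |exists (3 * t ^+ 2 + 4 * t + 1); right]; ring.
Qed.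

(** The multiplier j is at most 4, and p = 2 mod 3. If j = 2 then u^2 = 2 mod 3; if j = 3 then 3 | u
    and w^2 = p mod 3; both are impossible. If j = 4 then u and w are even, and one divides by 4. *)
Lemma prime_form_2_3 (p : nat) (X Y : int) : prime p -> (p %% 6 = 5)%N -> ~~ (p %| Y)%Z ->
  (p %| X ^+ 2 + 6 * Y ^+ 2)%Z -> exists u w : int, p%:Z = 2%N%:Z * u ^+ 2 + 3%N%:Z * w ^+ 2.
Proof.
move=> pp p6 pY pXY.
have [|u [w [j jr e]]] := @thue_form p 2 3 X Y pp isT isT _ pY pXY.
  by apply/negP => /dvdn_leq; clear -p6; lia.
have [s ps] : exists s : int, p%:Z = 3 * s + 2 by clear -p6; exists ((p %/ 3)%N%:Z); lia.
have [t ut] := sqr_mod3 u; have [r wr] := sqr_mod3 w.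
case: j jr e => [|[|[|[|[|j]]]]] // _ e.
- by exists u, w; rewrite e mul1r.
- by exfalso; clear -e ps ut; move: (u ^+ 2) (w ^+ 2) e ut => U W *; lia.
- exfalso.
  have : (3 %| u * u)%Z.
    apply/dvdzP; exists t; case: ut => ut; first by rewrite -expr2 ut mulrC.
    by exfalso; clear -e ut; move: (u ^+ 2) (w ^+ 2) e ut => U W *; lia.
  rewrite (@dvdz_prime_mul 3) // orbb => /dvdzP[u' eu].
  have {}e : p%:Z = 6 * u' ^+ 2 + w ^+ 2.
    by apply: (@mulfI _ 3%:Z) => //; rewrite -e eu; ring.
  by clear -e ps wr; move: (u' ^+ 2) (w ^+ 2) e wr => U W *; lia.
have [|w' ew] := @dvdz2_sqr w.
  apply/dvdzP; exists (2 * p%:Z - u ^+ 2 - w ^+ 2).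
  by clear -e; move: (u ^+ 2) (w ^+ 2) e => U W *; lia.
have [|u' eu] := @dvdz2_sqr u.
  have e' : u ^+ 2 + 6 * w' ^+ 2 = 2 * p%:Z.
    apply: (@mulfI _ 2%:Z) => //; apply: (etrans (y := 4%:Z * p%:Z)); last by ring.
    by rewrite -[RHS]e ew; ring.
  apply/dvdzP; exists (p%:Z - 3 * w' ^+ 2).
  by clear -e'; move: (u ^+ 2) (w' ^+ 2) e' => U W *; lia.
exists u', w'; apply: (@mulfI _ 4%:Z) => //; rewrite -[LHS]e eu ew; ring.
Qed.

Lemma sqr_mod4 (x : int) : exists t : int, exists r : bool, x ^+ 2 = 4 * t + r%:Z.
Proof.
have [q [r e]] : exists q : int, exists r : bool, x = 2 * q + r%:Z.
  exists (x %/ 2)%Z, (odd `|x|%N); clear; lia.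
exists (q ^+ 2 + (if r then q else 0)), r.
rewrite e; case: r {e}; first by rewrite -[true%:Z]/(1 : int); ring.
by rewrite !addr0 exprMn.
Qed.

(** Each multiplier j <= 3 fails: j = 1 gives u^2 = 2 mod 3; j = 2 gives u^2 + 3 w^2 = 2 mod 4; j =
    3 forces 3 | u and then w^2 = 2 mod 3. *)
Lemma prime_not_form_1_3 (p : nat) (X Y : int) : prime p -> (p %% 6 = 5)%N ->
  ~~ (p %| Y)%Z -> ~ (p %| X ^+ 2 + 3 * Y ^+ 2)%Z.
Proof.
move=> pp p6 pY pXY.
have [|u [w [j jr e]]] := @thue_form p 1 3 X Y pp isT isT _ pY pXY.
  by rewrite dvdn1; apply/eqP; clear -p6; lia.
have [s ps] : exists s : int, p%:Z = 6 * s + 5 by clear -p6; exists ((p %/ 6)%N%:Z); lia.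
have [t ut] := sqr_mod3 u.
case: j jr e => [|[|[|[|j]]]] // _ e; rewrite mul1r in e.
- by clear -e ps ut; move: (u ^+ 2) (w ^+ 2) e ut => U W *; lia.
- have [t1 [r1 e1]] := sqr_mod4 u; have [t2 [r2 e2]] := sqr_mod4 w.
  by clear -e ps e1 e2; move: (u ^+ 2) (w ^+ 2) e e1 e2 => U W *; lia.
have : (3 %| u * u)%Z.
  apply/dvdzP; exists (p%:Z - w ^+ 2); rewrite -expr2.
  by clear -e; move: (u ^+ 2) (w ^+ 2) e => U W *; lia.
rewrite (@dvdz_prime_mul 3) // orbb => /dvdzP[u' eu].
have {}e : p%:Z = 3 * u' ^+ 2 + w ^+ 2.
  by apply: (@mulfI _ 3%:Z) => //; rewrite -e eu; ring.
have [r wr] := sqr_mod3 w.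
by clear -e ps wr; move: (u' ^+ 2) (w ^+ 2) e wr => U W *; lia.
Qed.

End Thue.

(** * Counting positive solutions *)

Section PositiveRepresentations.

Definition pos_reps (a b N : nat) : nat :=
  \sum_(1 <= x < N.+1) \sum_(1 <= y < N.+1) (a * x ^ 2 + b * y ^ 2 == N).

Lemma sum_box (N : nat) (F : int -> nat) : (forall x, F (- x)%R = F x) ->
  \sum_(x <- box N) F x = F 0%R + 2 * \sum_(1 <= n < N.+1) F (Posz n).
Proof.
move=> FN; rewrite big_cons big_cat !big_map /= /index_iota subn1 /=; congr (_ + _).
by under [X in _ + X]eq_bigr => i _ do rewrite FN; lia.
Qed.

(** The hypotheses exclude solutions on the axes; the others come in fours by the choice of
    signs. *)
Lemma size_reps_pos (a b N : nat) :
  (forall x, a * x ^ 2 != N) -> (forall x, b * x ^ 2 != N) ->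
  size (reps a b N) = 4 * pos_reps a b N.
Proof.
move=> aN bN; rewrite size_filter -sum1_count big_mkcond big_allpairs.
pose F (x y : int) : nat := (a * `|x|%N ^ 2 + b * `|y|%N ^ 2 == N).
transitivity (\sum_(x <- box N) \sum_(y <- box N) F x y).
  apply: eq_bigr => x _; apply: eq_bigr => y _; rewrite !sqr_absz -!PoszM -PoszD eqz_nat /F.
  by case: eqP.
rewrite sum_box; last by move=> x; apply: eq_bigr => y _; rewrite /F abszN.
rewrite sum_box /F; last by move=> x; rewrite abszN.
have N0 : (0 == N) = false by have := bN 0; rewrite exp0n // muln0 => /negPf.
rewrite !absz0 !exp0n // !muln0 addn0 N0 [\sum_(1 <= n < _) _]big1 ?muln0; last first.
  by move=> y _; rewrite add0n (negPf (bN _)).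
rewrite !add0n /pos_reps -[4]/(2 * 2) -mulnA; congr (2 * _).
rewrite big_distrr; apply: eq_bigr => x _ /=; rewrite sum_box; last by move=> y; rewrite abszN.
by rewrite absz0 exp0n // muln0 addn0 (negPf (aN _)).
Qed.

(** Descent: the second hypothesis says that -k is not a square modulo p. It gives p | y, hence p |
    x; dividing by p^2 lowers e by one, until e = 0 forces p | M. *)
Lemma nonresidue_no_reps (p k M e : nat) (x y : int) : prime p ->
  (forall X Y : int, (p %| (X ^+ 2 + (Posz k) * Y ^+ 2)%R)%Z -> (p %| Y)%Z) ->
  ~~ (p %| M) -> (x ^+ 2 + (Posz k) * y ^+ 2)%R <> Posz (p ^ (2 * e + 1) * M).
Proof.
move=> pp res pM; have pz : (Posz p) != 0%R by rewrite eqz_nat -lt0n prime_gt0.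
have descent (K : int) x1 y1 : (x1 ^+ 2 + Posz k * y1 ^+ 2 = Posz p * K)%R ->
    exists x2 y2 : int, K = (Posz p * (x2 ^+ 2 + Posz k * y2 ^+ 2))%R.
  move=> exy.
  have pN : (p %| (x1 ^+ 2 + Posz k * y1 ^+ 2)%R)%Z by rewrite exy dvdz_mulr.
  have py := res _ _ pN.
  have : (p %| (x1 * x1)%R)%Z.
    rewrite (_ : x1 * x1 = x1 ^+ 2 + Posz k * y1 ^+ 2 - Posz k * y1 * y1)%R; last by ring.
    by rewrite rpredB // dvdz_mull.
  rewrite dvdz_prime_mul // orbb => /dvdzP[x2 ex]; have /dvdzP[y2 ey] := py.
  by exists x2, y2; apply: (mulfI pz); rewrite -exy ex ey; ring.
elim: e x y => [|e IHe] x y.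
  rewrite expn1 PoszM => /descent[x2 [y2 eM]]; case/negP: pM.
  have : (p %| Posz M)%Z by rewrite eM dvdz_mulr.
  by rewrite dvdzE.
rewrite (_ : p ^ _ * M = p * (p * (p ^ (2 * e + 1) * M))); last first.
  by rewrite (_ : 2 * e.+1 + 1 = (2 * e + 1).+2) ?expnS ?mulnA //; lia.
rewrite PoszM => /descent[x2 [y2]]; rewrite PoszM => /(mulfI pz) /esym.
exact: IHe.
Qed.

Lemma pos_reps0 a b N :
  (forall x y : nat, a * x ^ 2 + b * y ^ 2 <> N) -> pos_reps a b N = 0.
Proof.
move=> h; rewrite /pos_reps big1 // => x _; rewrite big1 // => y _.
by case: eqP => // /h.
Qed.

(** * Parity of the number of positive solutions of x^2 + k y^2 = N for k = 2, 3, 6 *)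

Section OddPower.
Variables (p M e : nat).
Hypotheses (p_prime : prime p) (p_mod6 : p %% 6 = 5).
Hypotheses (pNM : ~~ (p %| M)) (M_mod6 : M %% 6 = 5).
Let N := p ^ (2 * e + 1) * M.

Let p_odd : odd p. Proof. by clear -p_mod6; lia. Qed.
Let p_ge5 : 4 < p. Proof. by clear -p_mod6; lia. Qed.

Let pN_small a : 0 < a < 5 -> ~~ (p %| a).
Proof. by case/andP=> a0 a5; apply/negP => /dvdn_leq -/(_ a0); move: p_ge5 a5; clear; lia. Qed.

(** The p-adic valuation is even on the left and odd on the right. *)
Lemma odd_power_neq_sqr a x : 0 < a -> ~~ (p %| a) -> a * x ^ 2 != N.
Proof.
move=> a0 pa; apply/eqP => h; have p0 := prime_gt0 p_prime.
have M0 : 0 < M by case: (M) M_mod6.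
have x0 : 0 < x.
  by case: x h => //; rewrite muln0 => /esym/eqP; rewrite muln_eq0 expn_eq0; lia.
have : odd (logn p (a * x ^ 2)) = odd (logn p N) by rewrite h.
rewrite /N !lognM ?expn_gt0 ?x0 ?p0 // !lognX (@logn_prime p p) // eqxx muln1.
have la : logn p a = 0 by rewrite logn_coprime ?prime_coprime.
have lM : logn p M = 0 by rewrite logn_coprime ?prime_coprime.
by rewrite la lM; clear; lia.
Qed.

Let no_reps k : (forall X Y : int, (p %| (X ^+ 2 + (Posz k) * Y ^+ 2)%R)%Z -> (p %| Y)%Z) ->
  pos_reps 1 k N = 0.
Proof.
move=> res; apply: pos_reps0 => x y h.
apply: (@nonresidue_no_reps p k M e (Posz x) (Posz y) p_prime res pNM).
by rewrite -/N -h !PoszD !PoszM; ring.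
Qed.

Lemma pos_reps_1_3 : pos_reps 1 3 N = 0.
Proof.
apply: no_reps => X Y pXY; apply/negPn/negP => pY.
exact: (prime_not_form_1_3 p_prime p_mod6 pY pXY).
Qed.

(** Since M is neither [a] nor [b] times a square, its representations come in fours, which starts
    the Hecke induction; at N, 8 then divides four times the positive count. *)
Let via_form a b (u w : int) : 0 < a < 5 -> 0 < b < 5 ->
  (forall x, a * x ^ 2 != M) -> (forall x, b * x ^ 2 != M) ->
  (Posz p) = ((Posz a) * u ^+ 2 + (Posz b) * w ^+ 2)%R -> ~~ odd (pos_reps 1 (a * b) N).
Proof.
move=> ha hb aM bM e1; have [pa pb] := (pN_small ha, pN_small hb).
have M4 : 4 %| size (reps a b M) by rewrite size_reps_pos // dvdn_mulr.
have [_] := reps_odd_power_mod8 p_prime p_odd pa pb e1 e pNM M4.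
rewrite size_reps_pos => [|x|x]; first by rewrite (@dvdn_pmul2l 4 2) // dvdn2.
  by apply: odd_power_neq_sqr; rewrite ?pN_small.
apply: odd_power_neq_sqr; last by rewrite Euclid_dvdM // negb_or pa.
by case/andP: ha hb => ? _ /andP[? _]; rewrite muln_gt0; apply/andP.
Qed.

Let M_odd : odd M. Proof. by clear -M_mod6; lia. Qed.

Let M_neq_sqr x : 1 * x ^ 2 != M.
Proof.
apply/eqP => h; have [t] := sqr_mod3 (Posz x).
rewrite sqr_absz absz_nat; move: h; rewrite mul1n => -> ht.
by clear -M_mod6 ht; lia.
Qed.

Let M_neq_2sqr x : 2 * x ^ 2 != M.
Proof. by apply/eqP => h; move: M_odd; rewrite -h oddM. Qed.

Let M_neq_3sqr x : 3 * x ^ 2 != M.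
Proof. by apply/eqP => h; move: M_mod6; rewrite -h; clear; move: (x ^ 2); lia. Qed.

Lemma pos_reps_1_2 : ~~ odd (pos_reps 1 2 N).
Proof.
have [res|] := pselect (forall X Y : int, (p %| (X ^+ 2 + (Posz 2) * Y ^+ 2)%R)%Z -> (p %| Y)%Z).
  by rewrite no_reps.
move=> /existsNP[X /existsNP[Y /not_implyP[pXY /negP pY]]].
have [u [w e1]] := prime_form_1_2 p_prime p_odd pY pXY.
exact: (@via_form 1 2 u w).
Qed.

Lemma pos_reps_1_6 : ~~ odd (pos_reps 1 6 N).
Proof.
have [res|] := pselect (forall X Y : int, (p %| (X ^+ 2 + (Posz 6) * Y ^+ 2)%R)%Z -> (p %| Y)%Z).
  by rewrite no_reps.
move=> /existsNP[X /existsNP[Y /not_implyP[pXY /negP pY]]].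
have [u [w e1]] := prime_form_2_3 p_prime p_mod6 pY pXY.
exact: (@via_form 2 3 u w).
Qed.

End OddPower.
End PositiveRepresentations.

(** * A finite form of Gauss' theta identity *)

Section Shanks.
Local Open Scope ring_scope.
Variables (R : comNzRingType) (q : R) (v : nat -> R).
Hypothesis vK : forall j, (0 < j)%N -> (1 + q ^+ j) * v j = 1.

(** With [v j] standing for 1 / (1 + q^j), this is the tail of (q; q)_n / (-q; q)_n. *)
Let Q s n := \prod_(s.+1 <= j < n.+1) ((1 - q ^+ j) * v j).
Let D s n := q ^+ (s * n.+1) * Q s n * v s.

Let Qn s n : (s <= n)%N -> Q s n.+1 = Q s n * ((1 - q ^+ n.+1) * v n.+1).
Proof. by move=> sn; rewrite /Q big_nat_recr. Qed.

Let Qs s n : (s < n)%N -> Q s n = (1 - q ^+ s.+1) * v s.+1 * Q s.+1 n.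
Proof. by move=> sn; rewrite /Q big_ltn. Qed.

(** Telescoping certificate: the signed increment of [D] in n is the increment of [U] in s. *)
Let U n s := (-1) ^+ s * q ^+ (s * n.+1) * Q s.-1 n * v n.+1.

Let D_step s n : (s < n)%N ->
  (-1) ^+ s.+1 * (D s.+1 n.+1 - D s.+1 n) = U n s.+2 - U n s.+1.
Proof.
move=> sn; rewrite /D /U /= (Qn sn) (Qs sn).
rewrite (_ : s.+2 * n.+1 = n.+1 + s.+1 * n.+1)%N; last by rewrite mulSn.
rewrite exprD.
rewrite (_ : s.+1 * n.+2 = s.+1 + s.+1 * n.+1)%N; last by rewrite mulnS.
rewrite exprD.
have e1 := vK (ltn0Sn s); have e2 := vK (ltn0Sn n).
move: (q ^+ (s.+1 * n.+1)) (q ^+ s.+1) (q ^+ n.+1) (v s.+1) (v n.+1) (Q s.+1 n) e1 e2.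
move=> A a b x y P e1 e2; rewrite [_ ^+ s.+2]exprS.
move: ((-1) ^+ s.+1) => S.
(* Inserting (1 + b) y = 1 here and (1 + a) x = 1 below gives every term the factor S A P x y. *)
transitivity (S * (a * A * (P * ((1 - b) * y)) * x - A * P * x * ((1 + b) * y))).
  by rewrite e2; ring.
transitivity (-1 * S * (b * A) * (P * ((1 + a) * x)) * y - S * A * ((1 - a) * x * P) * y).
  by ring.
by rewrite e1; ring.
Qed.

(* Shanks' finite form of Gauss' identity; both sides satisfy the same recurrence in n,
   the sum over s telescoping through D_step. *)
Lemma shanks n :
  \prod_(1 <= j < n.+1) ((1 - q ^+ j) * v j) +
    \sum_(1 <= s < n.+1) (-1) ^+ s *+ 2 *
      (q ^+ (s * n.+1) * (\prod_(s.+1 <= j < n.+1) ((1 - q ^+ j) * v j)) * v s) =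
  1 + \sum_(1 <= s < n.+1) (-1) ^+ s *+ 2 * q ^+ (s * s).
Proof.
rewrite -/(Q 0 n).
under eq_bigr => s _ do rewrite -/(Q s n) -/(D s n).
elim: n => [|n IHn]; first by rewrite /Q !big_geq.
rewrite [in RHS]big_nat_recr //= addrA -IHn [in LHS]big_nat_recr //=.
apply/eqP; rewrite -subr_eq0; apply/eqP.
have E : \sum_(1 <= s < n.+1) (-1) ^+ s *+ 2 * D s n.+1 =
   \sum_(1 <= s < n.+1) (-1) ^+ s *+ 2 * D s n + (U n n.+1 - U n 1) *+ 2.
  rewrite -telescope_sumr // -sumrMnl -big_split /= big_nat [RHS]big_nat.
  apply: eq_bigr => -[|s] // /andP[_ sn].
  by rewrite -D_step //; ring.
rewrite E Qn // /U /D /= mul1n expr1 (_ : Q n.+1 n.+1 = 1); last by rewrite /Q big_geq.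
rewrite (_ : Q n n = 1); last by rewrite /Q big_geq.
rewrite (_ : n.+1 * n.+2 = n.+1 + n.+1 * n.+1)%N; last by rewrite mulnS.
rewrite exprD.
have e2 := vK (ltn0Sn n).
move: (\sum_(_ <= _ < _) _) (q ^+ (n.+1 * n.+1)) (q ^+ n.+1) (v n.+1) (Q 0 n) e2.
move=> S A b y P e2; move: ((-1) ^+ n.+1) => T.
(* The end [U n 1] joins the [Q 0 n] terms and the end [U n n.+1] the q^((n+1)^2) terms; each group
   vanishes by (1 + b) y = 1. *)
transitivity (P * ((1 - b) * y + 2 * b * y - 1) + 2 * T * A * ((1 + b) * y - 1)); first by ring.
rewrite e2 (_ : (1 - b) * y + 2 * b * y = (1 + b) * y); last by ring.
by rewrite e2; ring.
Qed.

End Shanks.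

(** * Theta series and the generating function modulo 8 *)

Section ThetaSeries.
Local Open Scope ring_scope.
Implicit Types (a b : {fps int}).

(** The bound x <= n loses no term of t_k for k > 0, since then x <= k x^2. *)
Definition theta_tail (k : nat) : {fps int} :=
  FPS (fun n => \sum_(1 <= x < n.+1) (-1) ^+ x * (k * x ^ 2 == n)%N%:R).

Lemma coefs_sum (I : Type) (r : seq I) (P : pred I) (F : I -> {fps int}) n :
  coefs (\sum_(i <- r | P i) F i) n = \sum_(i <- r | P i) coefs (F i) n.
Proof. by rewrite (big_morph (fun a => coefs a n) (fun a b => coefsD a b n) (coefs0 _ n)). Qed.

Lemma coefs_mulrn a k n : coefs (a *+ k) n = coefs a n *+ k.
Proof. by elim: k => [|k IHk]; rewrite ?mulr0n ?coefs0 // !mulrS coefsD IHk. Qed.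

Lemma coefs_Xn_mul_small a m n : (n < m)%N -> coefs ('q ^+ m * a) n = 0.
Proof.
move=> nm; rewrite coefsM big1 // => i _; rewrite coefs_fpsXn.
by rewrite (_ : (i == m :> nat) = false) ?mul0r //; have := ltn_ord i; lia.
Qed.

Lemma coefs_theta_tail k n N : (0 < k)%N -> (n <= N)%N ->
  coefs (theta_tail k) n = \sum_(1 <= x < N.+1) (-1) ^+ x * (k * x ^ 2 == n)%N%:R.
Proof.
move=> k0 nN; rewrite [RHS](big_cat_nat (n := n.+1)) //= [X in _ = _ + X]big_nat.
rewrite [X in _ = _ + X]big1 ?addr0 // => x /andP[nx _].
by rewrite (_ : (_ == _)%N = false) ?mulr0 //; clear -k0 nx; nia.
Qed.

Lemma coefs_sign2_mul a n s :
  coefs ((-1) ^+ s *+ 2 * a) n = ((-1) ^+ s * coefs a n) *+ 2.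
Proof.
rewrite mulrnAl (coefs_mulrn (_ * _)); congr (_ *+ 2).
by elim: s => [|s IHs]; rewrite ?expr0 ?mul1r // !exprS !mulN1r !mulNr coefsN IHs.
Qed.

Lemma one_addXn_unit m : (0 < m)%N -> (1 + 'q ^+ m) \is a GRing.unit.
Proof. by move=> m0; apply: (@fps_eqm1_unit 1) => //; exact: fps_eqm1DXn. Qed.

(** The limit of [shanks] at q^k, using (1 - x)^2 = (1 - x^2) (1 - x) / (1 + x) factor by factor. *)
Lemma gauss_theta k : (0 < k)%N ->
  euler_f k ^+ 2 = euler_f (2 * k) * (1 + theta_tail k *+ 2).
Proof.
move=> k0; pose v j : {fps int} := (1 + ('q ^+ k) ^+ j)^-1.
have vK j : (0 < j)%N -> (1 + ('q ^+ k) ^+ j) * v j = 1.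
  by move=> j0; rewrite /v divrr // -exprM one_addXn_unit // muln_gt0 k0.
pose P N := \prod_(1 <= j < N.+1) ((1 - ('q ^+ k) ^+ j) * v j).
apply: (fps_cvg_unique (fps_cvgX 2 (euler_f_cvg k0))).
have k20 : (0 < 2 * k)%N by rewrite muln_gt0.
rewrite (_ : (fun N => _) = fun N =>
    \prod_(1 <= j < N.+1) (1 - 'q ^+ (2 * k * j)) * P N); last first.
  apply/funext => N; rewrite /P -prodrXl -big_split /=.
  rewrite big_nat [RHS]big_nat; apply: eq_bigr => j /andP[j0 _].
  rewrite -exprM -mulnA [(2 * _)%N]mulnC (exprM _ (k * j) 2).
  have := vK j j0; rewrite -exprM; move: ('q ^+ (k * j)) (v j) => x y e.
  rewrite -[LHS]mulr1 -[X in _ * X = _]e.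
  by ring.
apply: fps_cvgM; first exact: euler_f_cvg.
move=> n; exists n => N nN.
have /(congr1 (fun a => coefs a n)) := shanks vK N.
(* The correction terms carry q^(k s (N + 1)), beyond degree n <= N. *)
rewrite !coefsD -/(P N) !coefs_sum [X in _ + X]big_nat big1 ?addr0; last first.
  move=> s /andP[s0 _]; rewrite coefs_sign2_mul -mulrA -exprM.
  by rewrite coefs_Xn_mul_small ?mulr0 ?mul0rn //; clear -s0 k0 nN; nia.
move=> ->; rewrite (coefs_theta_tail k0 nN) -mulr2n -sumrMnl; congr (_ + _).
apply: eq_bigr => s _; rewrite coefs_sign2_mul -exprM coefs_fpsXn.
by rewrite eq_sym.
Qed.

Lemma coefs_theta_mul (a b N : nat) : (0 < a)%N -> (0 < b)%N ->
  coefs (theta_tail a * theta_tail b) N =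
  \sum_(1 <= x < N.+1) \sum_(1 <= y < N.+1)
     (-1) ^+ (x + y) * (a * x ^ 2 + b * y ^ 2 == N)%N%:R.
Proof.
move=> a0 b0; rewrite coefsM.
under eq_bigr => i _ do rewrite (coefs_theta_tail a0 (leq_ord i))
  (coefs_theta_tail b0 (leq_subr i N)) big_distrlr.
rewrite exchange_big; apply: eq_bigr => x _ /=.
rewrite exchange_big; apply: eq_bigr => y _ /=.
have [aN|aN] := leqP (a * x ^ 2) N; last first.
  rewrite big1 => [|i _]; last first.
    by rewrite (_ : (_ == i :> nat) = false) ?mulr0 ?mul0r //; have := ltn_ord i; lia.
  by rewrite (_ : (_ == N) = false) ?mulr0 //; lia.
rewrite (bigD1 (Ordinal (aN : (a * x ^ 2 < N.+1)%N))) //= eqxx mulr1 big1 ?addr0.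
  rewrite exprD -mulrA; congr (_ * (_ * _%:R)).
  by move: aN; move: (a * _)%N (b * _)%N => A B; lia.
by move=> i /negP ne; rewrite (_ : (_ == i :> nat) = false) ?mulr0 ?mul0r //;
  apply/negP => /eqP e; apply: ne; rewrite -val_eqE /= e.
Qed.

(** Signs do not matter modulo 2, so the coefficient has the parity of [pos_reps]. *)
Lemma coefs_theta_mul_even (a b N : nat) : (0 < a)%N -> (0 < b)%N ->
  ~~ odd (pos_reps a b N) -> (2 %| coefs (theta_tail a * theta_tail b) N)%Z.
Proof.
move=> a0 b0 ev; rewrite coefs_theta_mul //.
have ev' : (2 %| Posz (pos_reps a b N))%Z by rewrite dvdzE /= dvdn2.
rewrite -(rpredBr _ ev') -natz /pos_reps natr_sum -sumrB; apply: rpred_sum => x _.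
rewrite natr_sum -sumrB; apply: rpred_sum => y _.
rewrite -signr_odd; case: (_ == N)%N; case: (odd _) => //.
Qed.

(** The swap of i and N - i pairs equal terms and has no fixed point for odd N. *)
Lemma coefs_sqr_even a N : odd N -> (2 %| coefs (a * a) N)%Z.
Proof.
move=> oN; rewrite coefsM (bigID (fun i : 'I__ => (i <= N./2)%N)) /=.
rewrite [X in _ + X](reindex_inj rev_ord_inj) /=.
rewrite [X in _ + X](eq_big (fun i : 'I__ => (i <= N./2)%N)
   (fun i : 'I__ => coefs a i * coefs a (N - i)%N)).
- by set S := (X in (_ %| X + _)%Z); apply/dvdzP; exists S; ring.
- by move=> i; have := ltn_ord i; lia.
by move=> i _; rewrite subSS subKn 1?mulrC // -ltnS.
Qed.

Lemma euler_f_unit k : (0 < k)%N -> euler_f k \is a GRing.unit.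
Proof.
move=> k0; apply: (fps_cvg_unit _ (euler_f_cvg k0)) => N.
rewrite big_nat; apply: rpred_prod => j /andP[j0 _].
by apply: fps_eqm1_unit j0 _; apply/fps_eqm1BXn/leq_pmull.
Qed.

(** Gauss' identity for k = 1, 2, 3, 6 in the eta quotient; the unit f_2 f_4 f_6 f_12 cancels. *)
Lemma schur_gf1_theta :
  schur_gf 1 * (1 + theta_tail 1 *+ 2) * (1 + theta_tail 6 *+ 2) =
  (1 + theta_tail 2 *+ 2) * (1 + theta_tail 3 *+ 2).
Proof.
have e1 : euler_f 1 ^+ 2 = euler_f 2 * (1 + theta_tail 1 *+ 2) := @gauss_theta 1 isT.
have e2 : euler_f 2 ^+ 2 = euler_f 4 * (1 + theta_tail 2 *+ 2) := @gauss_theta 2 isT.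
have e3 : euler_f 3 ^+ 2 = euler_f 6 * (1 + theta_tail 3 *+ 2) := @gauss_theta 3 isT.
have e6 : euler_f 6 ^+ 2 = euler_f 12 * (1 + theta_tail 6 *+ 2) := @gauss_theta 6 isT.
have := schur_gf_eta 1; rewrite !muln1 !expr1 => eG.
have D : schur_gf 1 * (euler_f 1 ^+ 2 * euler_f 4 * euler_f 6 ^+ 3) =
    euler_f 2 ^+ 3 * euler_f 3 ^+ 2 * euler_f 12.
  by rewrite eG divrK // !unitrM !euler_f_unit.
have W : euler_f 2 * euler_f 4 * euler_f 6 * euler_f 12 \is a GRing.unit.
  by rewrite !unitrM !euler_f_unit.
apply: (mulIr W); move: D.
rewrite (exprS _ 2) e6 (exprS (euler_f 2) 2) e2 e1 e3.
move: (euler_f _) (euler_f _) (euler_f _) (euler_f _) (schur_gf 1) => f2 f4 f6 f12 G.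
move: (theta_tail _) (theta_tail _) (theta_tail _) (theta_tail _) => t1 t2 t3 t6 D.
apply: (etrans _ (etrans D _)); ring.
Qed.

Lemma schur_gf_mod8 m :
  let t := theta_tail in
  exists C : {fps int}, schur_gf (4 * m + 1) =
   1 + (t 2 + t 3 - t 1 - t 6) *+ 2 +
   (t 2 * t 3 - t 1 * t 2 - t 2 * t 6 - t 1 * t 3 - t 3 * t 6 + t 1 * t 6
      + t 1 * t 1 + t 6 * t 6) *+ 4 + C *+ 8.
Proof.
move=> t; have [C1 eG] : exists C : {fps int}, schur_gf 1 =
   1 + (t 2 + t 3 - t 1 - t 6) *+ 2 +
   (t 2 * t 3 - t 1 * t 2 - t 2 * t 6 - t 1 * t 3 - t 3 * t 6 + t 1 * t 6
      + t 1 * t 1 + t 6 * t 6) *+ 4 + C *+ 8.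
  have := schur_gf1_theta; rewrite -/(t 1%N) -/(t 2) -/(t 3) -/(t 6).
  move: (schur_gf 1) (t 1%N) (t 2) (t 3) (t 6) => G t1 t2 t3 t6 e.
  (* Inverse of 1 + 2s modulo 8: (1 + 2s) W s = 1 + 8 s^3. *)
  pose W s : {fps int} := 1 - s *+ 2 + s * s *+ 4.
  have e' : G * (1 + t1 * t1 * t1 *+ 8) * (1 + t6 * t6 * t6 *+ 8) =
      (1 + t2 *+ 2) * (1 + t3 *+ 2) * W t1 * W t6 by rewrite -e /W; ring.
  pose X := 1 + (t2 + t3 - t1 - t6) *+ 2 +
   (t2 * t3 - t1 * t2 - t2 * t6 - t1 * t3 - t3 * t6 + t1 * t6
      + t1 * t1 + t6 * t6) *+ 4.
  (* 8 z is the part of total degree above 2 in the product of [W t1] and [W t6]. *)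
  pose z := t1 * t1 * t6 * t6 *+ 2 - t1 * t1 * t6 - t1 * t6 * t6.
  pose K := (t2 + t3) * (t1 * t1 + t6 * t6 + t1 * t6) - t2 * t3 * (t1 + t6)
    + t2 * t3 * (t1 * t1 + t6 * t6 + t1 * t6) *+ 2
    + z * (1 + (t2 + t3) *+ 2 + t2 * t3 *+ 4).
  have eK : (1 + t2 *+ 2) * (1 + t3 *+ 2) * W t1 * W t6 = X + K *+ 8.
    by rewrite /W /X /K /z; ring.
  exists (K - G * (t1 * t1 * t1 + t6 * t6 * t6 + t1 * t1 * t1 * (t6 * t6 * t6) *+ 8)).
  apply: (etrans (y := (X + K *+ 8) - (G * (1 + t1 * t1 * t1 *+ 8) * (1 + t6 * t6 * t6 *+ 8) - G))).
    by rewrite e' eK; ring.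
  by rewrite /X; ring.
have [H eH] : exists H, schur_gf 1 = 1 + H *+ 2.
  exists (t 2 + t 3 - t 1 - t 6 +
   (t 2 * t 3 - t 1 * t 2 - t 2 * t 6 - t 1 * t 3 - t 3 * t 6 + t 1 * t 6
      + t 1 * t 1 + t 6 * t 6) *+ 2 + C1 *+ 4).
  by rewrite eG; ring.
have e4 : exists C, schur_gf 1 ^+ 4 = 1 + C *+ 8.
  (* Binomial expansion of (1 + 2H)^4 = 1 + 8H + 24H^2 + 32H^3 + 16H^4. *)
  exists (H + H ^+ 2 *+ 3 + H ^+ 3 *+ 4 + H ^+ 4 *+ 2); rewrite eH; ring.
have [C2 e4m] : exists C, (schur_gf 1 ^+ 4) ^+ m = 1 + C *+ 8.
  have [C ->] := e4; elim: m => [|m [C' e]]; first by exists 0; rewrite mul0rn addr0.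
  by exists (C + C' + C * C' *+ 8); rewrite exprS e; ring.
exists (C1 + C2 * schur_gf 1).
have -> : schur_gf (4 * m + 1) = schur_gf 1 ^+ (4 * m + 1).
  move: (4 * m + 1)%N => r; rewrite !schur_gf_eta !muln1 !expr1 expr_div_n.
  by rewrite !(exprM _ _ r) -!exprMn.
rewrite addn1 exprSr exprM e4m mulrDl mul1r {1}eG mulrnAl mulrnDl; ring.
Qed.

End ThetaSeries.

(** * The coefficient at N modulo 8 *)

Lemma coefs_theta_tail0 k N : (forall x, k * x ^ 2 != N) -> coefs (theta_tail k) N = 0%R.
Proof. by move=> h; rewrite /= big1 // => x _; rewrite (negPf (h x)) mulr0. Qed.

Theorem theorem4p10 (p m alpha n i : nat)
    (p_prime : prime p) (p_mod6 : p = 5 %[mod 6]) (i_range : 1 <= i <= p - 1) :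
  (S3 (4 * m + 1)
      (6 * p ^ (2 * alpha + 2) * n + (6 * i + p) * p ^ (2 * alpha + 1))
    = 0 %[mod 8])%Z.
Proof.
have p6 : p %% 6 = 5 by rewrite p_mod6.
pose M := 6 * (p * n + i) + p; set N := (X in S3 _ X).
have NE : N = p ^ (2 * alpha + 1) * M.
  by rewrite /N /M (_ : 2 * alpha + 2 = (2 * alpha + 1).+1) ?expnS; [ring | clear; lia].
have M6 : M %% 6 = 5 by rewrite /M -modnDml modnMr add0n.
(* Otherwise p would divide 6 i, but p >= 5 and 0 < i < p. *)
have pNM : ~~ (p %| M).
  rewrite /M dvdn_addl // Euclid_dvdM // negb_or (@Euclid_dvdM 2 3) // negb_or.
  rewrite dvdn_addr ?dvdn_mulr //; apply/andP; split; first apply/andP; [split|];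
    apply/negP => /dvdn_leq; clear -p6 i_range; lia.
have N6 : N %% 6 = 1.
  rewrite NE -modnMml -modnXm p6 -modnMmr M6 modnMml.
  rewrite expnD expnM -mulnA -modnMml -modnXm (_ : 5 ^ 2 %% 6 = 1) //.
  by rewrite exp1n.
have Nodd : odd N by clear -N6; lia.
(* k = 1 is excluded by the odd p-adic valuation of N, the others because N is prime to 6. *)
have no_lin k : k \in [:: 1; 2; 3; 6] -> coefs (theta_tail k) N = 0%R.
  move=> hk; apply: coefs_theta_tail0 => x; move: hk; rewrite !inE => /or4P[] /eqP ->.
  - rewrite NE; apply: odd_power_neq_sqr => //.
    by rewrite dvdn1; apply/eqP; clear -p6; lia.
  - by apply/eqP => h; rewrite -h in N6; move: N6; clear; move: (x ^ 2) => y; lia.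
  - by apply/eqP => h; rewrite -h in N6; move: N6; clear; move: (x ^ 2) => y; lia.
  - by apply/eqP => h; rewrite -h in N6; move: N6; clear; move: (x ^ 2) => y; lia.
have mul_even a b : 0 < a -> 0 < b -> ~~ odd (pos_reps a b N) ->
    (2 %| coefs (theta_tail a * theta_tail b)%R N)%Z by exact: coefs_theta_mul_even.
have e12 : (2 %| coefs (theta_tail 1 * theta_tail 2)%R N)%Z.
  by apply: mul_even => //; rewrite NE pos_reps_1_2.
have e13 : (2 %| coefs (theta_tail 1 * theta_tail 3)%R N)%Z.
  by apply: mul_even => //; rewrite NE pos_reps_1_3.
have e16 : (2 %| coefs (theta_tail 1 * theta_tail 6)%R N)%Z.
  by apply: mul_even => //; rewrite NE pos_reps_1_6.
have e23 : (2 %| coefs (theta_tail 2 * theta_tail 3)%R N)%Z.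
  (* Modulo 3 the form is 2 x^2, which is never 1. *)
  apply: mul_even => //; rewrite pos_reps0 // => x y h; rewrite -h in N6.
  have [t] := sqr_mod3 x; rewrite sqr_absz absz_nat; move: N6; clear.
  by move: (x ^ 2) (y ^ 2) => X Y; lia.
have e26 : (2 %| coefs (theta_tail 2 * theta_tail 6)%R N)%Z.
  apply: mul_even => //; rewrite pos_reps0 // => x y h; move: Nodd; rewrite -h.
  by rewrite oddD !oddM.
have e36 : (2 %| coefs (theta_tail 3 * theta_tail 6)%R N)%Z.
  apply: mul_even => //; rewrite pos_reps0 // => x y h; move: N6; rewrite -h; clear.
  by move: (x ^ 2) (y ^ 2) => X Y; lia.
have e11 := coefs_sqr_even (theta_tail 1) Nodd.
have e66 := coefs_sqr_even (theta_tail 6) Nodd.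
apply/eqP.
rewrite (eqz_mod_dvd 8 _ 0).
rewrite subr0 /S3.
have [C ->] := schur_gf_mod8 m.
rewrite !(coefsD, coefsN, coefs_mulrn) coefs1 !no_lin // (_ : N == 0 = false); last first.
  by apply/eqP; clear -N6; lia.
move: e12 e13 e16 e23 e26 e36 e11 e66; clear.
move=> /dvdzP[a ->] /dvdzP[b ->] /dvdzP[c ->] /dvdzP[d ->] /dvdzP[e ->] /dvdzP[f ->].
move=> /dvdzP[g ->] /dvdzP[h ->]; move: (coefs C N) => k.
(* The halves of the eight product coefficients, with their signs in the expansion, plus the
   coefficient of the remainder [C]. *)
apply/dvdzP; exists (d - a - e - b - f + c + g + h + k)%R.
by rewrite mulr0n; ring.
Qed.
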